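(* Let $R$ be a ring in which $2$ is a unit, and assume $\operatorname{rank}(\mathbf{V})\geq3$. Let $\tau\in\mathbf{M}_{\mathrm{stab}}(R)$, $a\in\mathbf{G}(R)$ and $y\in\mathbf{X}_{\tau,a}(R)$. Then the following are equivalent: (i) $\mathbf{X}_{\tau,a}$ is doubly-tangential at $y$ over $R$; (ii) $a\in\mathbf{H}(R)\mathbf{Z}(R)$.
   Context: Rings are commutative with $1$. Let $\mathbf{V}$ be a free $\mathbb{Z}$-module of finite rank, $\mathbf{V}^*=\mathrm{Hom}(\mathbf{V},\mathbb{Z})$; fix $e\in\mathbf{V}$, $e^*\in\mathbf{V}^*$ with $e^*(e)=1$. For a ring $R$: $\mathbf{V}(R)=\mathbf{V}\otimes R$, $\mathbf{V}^*(R)=\mathrm{Hom}_R(\mathbf{V}(R),R)$, $\mathbf{M}(R)=\mathrm{End}_R(\mathbf{V}(R))$, $\mathbf{G}(R)=\mathrm{Aut}_R(\mathbf{V}(R))$, $\mathbf{Z}(R)=R^\times$ (scalars). Juxtaposition: $\ell v=\ell(v)$, $xv=x(v)$, $\ell x=\ell\circ x$, $v\ell=(u\mapsto\ell(u)v)$. $\mathbf{V}_H(R)=\{v:e^*v=0\}$, $1_H=1-ee^*$, $\mathbf{M}_H(R)=\mathrm{End}_R(\mathbf{V}_H(R))$ (extended by $0$ on $Re$), $\mathbf{H}(R)=\mathrm{Aut}_R(\mathbf{V}_H(R))$ acting trivially on $Re$ (i.e. $\{g\in\mathbf{G}(R):ge=e,\ e^*g=e^*\}$), $\tau_H=1_H\tau1_H$.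 For an $R$-algebra $R'$: $\mathbf{G}_\tau(R')$ = centralizer of $\tau$ in $\mathbf{G}(R')$; $\mathbf{H}_\sigma(R')$ = centralizer of $\sigma\in\mathbf{M}_H(R)$ in $\mathbf{H}(R')$. $v$ (resp. $\ell$) is $\tau$-cyclic if $R[\tau]v=\mathbf{V}(R)$ (resp. $\ell R[\tau]=\mathbf{V}^*(R)$); $\tau$ is stable if $e$ and $e^*$ are $\tau$-cyclic; $\mathbf{M}_{\mathrm{stab}}(R)$ = stable elements. For $\tau$ stable, $a\in\mathbf{G}(R)$: $\mathbf{X}_{\tau,a}(R')=\{y\in\mathbf{H}_{\tau_H}(R'): ay\in\mathbf{H}(R')\mathbf{G}_\tau(R')\}$. Let $R''=R[\varepsilon_1,\varepsilon_2]/(\varepsilon_1^2,\varepsilon_2^2)$ with the map $R''\to R$ sending $\varepsilon_1,\varepsilon_2\mapsto0$. For $y\in\mathbf{X}_{\tau,a}(R)$, $\mathbf{X}_{\tau,a}$ is doubly-tangential at $y$ over $R$ if every $y''\in\mathbf{H}_{\tau_H}(R'')$ mapping to $y$ under $\mathbf{H}_{\tau_H}(R'')\to\mathbf{H}_{\tau_H}(R)$ lies in $\mathbf{X}_{\tau,a}(R'')$. *)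

(* Defs.v *)
From HB Require Import structures.
From mathcomp Require Import all_boot all_order all_algebra.
From mathcomp Require Import ring.
Set Implicit Arguments.
Unset Strict Implicit.
Unset Printing Implicit Defensive.
Import GRing.Theory.
Local Open Scope ring_scope.

(* Rings are comPzRingType's, so that the zero ring is allowed.
   A basis of the free Z-module V is fixed, i.e. V = Z^n:
     V(R) = 'cV[R]_n,  V^*(R) = 'rV[R]_n,  M(R) = End_R(V(R)) = 'M[R]_n;
   the juxtapositions l v, x v, l x, v l are all matrix products *m. *)

Definition base_change (R : comPzRingType) m n (A : 'M[int]_(m, n)) :
  'M[R]_(m, n) := map_mx (intr : int -> R) A.

(* unitRingType excludes the zero ring, so units are spelled out. *)
Definition is_unit (R : comPzRingType) (x : R) : Prop :=
  exists y : R, x * y = 1.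

Definition in_G (R : comPzRingType) n (g : 'M[R]_n) : Prop :=
  exists g' : 'M[R]_n, g *m g' = 1%:M /\ g' *m g = 1%:M.

Definition in_Z (R : comPzRingType) n (z : 'M[R]_n) : Prop :=
  exists2 c : R, is_unit c & z = c%:M.

(* x \in R[tau], the R-subalgebra of M(R) generated by tau *)
Definition in_alg_gen (R : comPzRingType) n (tau x : 'M[R]_n) : Prop :=
  exists s : seq R, x = \sum_(i < size s) s`_i *: tau ^+ i.

Definition cyclic_vector (R : comPzRingType) n (tau : 'M[R]_n)
    (v : 'cV[R]_n) : Prop :=
  forall w : 'cV[R]_n, exists2 x, in_alg_gen tau x & w = x *m v.

Definition cyclic_covector (R : comPzRingType) n (tau : 'M[R]_n)
    (l : 'rV[R]_n) : Prop :=
  forall w : 'rV[R]_n, exists2 x, in_alg_gen tau x & w = l *m x.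

Section Pointed.

Variables (n : nat) (e : 'cV[int]_n) (es : 'rV[int]_n).

Definition stable (R : comPzRingType) (tau : 'M[R]_n) : Prop :=
  cyclic_vector tau (base_change R e) /\
  cyclic_covector tau (base_change R es).

(* The automorphisms of V_H(R) = ker e^*, extended by the identity on Re. *)
Definition in_H (R : comPzRingType) (g : 'M[R]_n) : Prop :=
  [/\ in_G g, g *m base_change R e = base_change R e
    & base_change R es *m g = base_change R es].

Definition one_H (R : comPzRingType) : 'M[R]_n :=
  1%:M - base_change R e *m base_change R es.

Definition compr_H (R : comPzRingType) (tau : 'M[R]_n) : 'M[R]_n :=
  one_H R *m tau *m one_H R.

(* From here on, an R-algebra R' is given by its structure morphism f. *)

Definition in_G_cent (R R' : comPzRingType) (f : {rmorphism R -> R'})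
    (tau : 'M[R]_n) (g : 'M[R']_n) : Prop :=
  in_G g /\ g *m map_mx f tau = map_mx f tau *m g.

Definition in_H_cent (R R' : comPzRingType) (f : {rmorphism R -> R'})
    (sigma : 'M[R]_n) (h : 'M[R']_n) : Prop :=
  in_H h /\ h *m map_mx f sigma = map_mx f sigma *m h.

Definition in_X (R R' : comPzRingType) (f : {rmorphism R -> R'})
    (tau a : 'M[R]_n) (y : 'M[R']_n) : Prop :=
  in_H_cent f (compr_H tau) y /\
  exists h g : 'M[R']_n,
    [/\ in_H h, in_G_cent f tau g & map_mx f a *m y = h *m g].

End Pointed.

(* bidual R is R[e1, e2]/(e1^2, e2^2), with R-basis 1, e1, e2, e1 e2;
   Bidual x x1 x2 x12 is x + x1 e1 + x2 e2 + x12 e1 e2. *)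
Record bidual (R : Type) := Bidual { bd0 : R; bd1 : R; bd2 : R; bd12 : R }.

Definition bidual_tuple (R : Type) (x : bidual R) : R * R * R * R :=
  (bd0 x, bd1 x, bd2 x, bd12 x).
Definition tuple_bidual (R : Type) (t : R * R * R * R) : bidual R :=
  let: (x, x1, x2, x12) := t in Bidual x x1 x2 x12.
Lemma bidual_tupleK (R : Type) : cancel (@bidual_tuple R) (@tuple_bidual R).
Proof. by case. Qed.

HB.instance Definition _ (R : choiceType) :=
  Choice.copy (bidual R) (can_type (@bidual_tupleK R)).

Section BidualRing.

Variable R : comPzRingType.
Implicit Types x y z : bidual R.

Definition bidual_add x y := Bidual
  (bd0 x + bd0 y) (bd1 x + bd1 y) (bd2 x + bd2 y) (bd12 x + bd12 y).
Definition bidual_opp x := Bidual (- bd0 x) (- bd1 x) (- bd2 x) (- bd12 x).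
Definition bidual_mul x y := Bidual
  (bd0 x * bd0 y)
  (bd0 x * bd1 y + bd1 x * bd0 y)
  (bd0 x * bd2 y + bd2 x * bd0 y)
  (bd0 x * bd12 y + bd1 x * bd2 y + bd2 x * bd1 y + bd12 x * bd0 y).

Definition bidual_const (c : R) : bidual R := Bidual c 0 0 0.

Fact bidual_addA : associative bidual_add.
Proof. by move=> [????] [????] [????]; congr Bidual => /=; ring. Qed.
Fact bidual_addC : commutative bidual_add.
Proof. by move=> [????] [????]; congr Bidual => /=; ring. Qed.
Fact bidual_add0 : left_id (bidual_const 0) bidual_add.
Proof. by move=> [????]; congr Bidual => /=; ring. Qed.
Fact bidual_addN : left_inverse (bidual_const 0) bidual_opp bidual_add.
Proof. by move=> [????]; congr Bidual => /=; ring. Qed.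
HB.instance Definition _ := GRing.isZmodule.Build (bidual R)
  bidual_addA bidual_addC bidual_add0 bidual_addN.

Fact bidual_mulA : associative bidual_mul.
Proof. by move=> [????] [????] [????]; congr Bidual => /=; ring. Qed.
Fact bidual_mulC : commutative bidual_mul.
Proof. by move=> [????] [????]; congr Bidual => /=; ring. Qed.
Fact bidual_mul1 : left_id (bidual_const 1) bidual_mul.
Proof. by move=> [????]; congr Bidual => /=; ring. Qed.
Fact bidual_mulDl : left_distributive bidual_mul bidual_add.
Proof. by move=> [????] [????] [????]; congr Bidual => /=; ring. Qed.
HB.instance Definition _ := GRing.Zmodule_isComPzRing.Build (bidual R)
  bidual_mulA bidual_mulC bidual_mul1 bidual_mulDl.

Fact bidual_const_zmod_morphism : zmod_morphism bidual_const.
Proof. by move=> c d; congr Bidual => /=; ring. Qed.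
Fact bidual_const_monoid_morphism : monoid_morphism bidual_const.
Proof. by split=> // c d; congr Bidual => /=; ring. Qed.
HB.instance Definition _ := GRing.isZmodMorphism.Build R (bidual R)
  bidual_const bidual_const_zmod_morphism.
HB.instance Definition _ := GRing.isMonoidMorphism.Build R (bidual R)
  bidual_const bidual_const_monoid_morphism.

(* The map R[e1, e2]/(e1^2, e2^2) -> R sending e1 and e2 to 0 is bd0. *)
Fact bd0_zmod_morphism : zmod_morphism (@bd0 R).
Proof. by []. Qed.
Fact bd0_monoid_morphism : monoid_morphism (@bd0 R).
Proof. by []. Qed.
HB.instance Definition _ := GRing.isZmodMorphism.Build (bidual R) R
  (@bd0 R) bd0_zmod_morphism.
HB.instance Definition _ := GRing.isMonoidMorphism.Build (bidual R) R
  (@bd0 R) bd0_monoid_morphism.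

Definition eps1 : bidual R := Bidual 0 1 0 0.
Definition eps2 : bidual R := Bidual 0 0 1 0.

Lemma eps1_sqr : eps1 ^+ 2 = 0.
Proof. by congr Bidual => /=; ring. Qed.
Lemma eps2_sqr : eps2 ^+ 2 = 0.
Proof. by congr Bidual => /=; ring. Qed.

Lemma bidualE x : x = bidual_const (bd0 x) + bidual_const (bd1 x) * eps1
  + bidual_const (bd2 x) * eps2 + bidual_const (bd12 x) * (eps1 * eps2).
Proof. by case: x => ????; congr Bidual => /=; ring. Qed.

(* The universal property of the quotient R[e1, e2]/(e1^2, e2^2). *)
Lemma bidual_universal (A : comPzRingType) (f : {rmorphism R -> A})
    (a1 a2 : A) : a1 ^+ 2 = 0 -> a2 ^+ 2 = 0 ->
  exists F : {rmorphism bidual R -> A},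
    [/\ forall c, F (bidual_const c) = f c, F eps1 = a1, F eps2 = a2
      & forall F' : {rmorphism bidual R -> A},
          (forall c, F' (bidual_const c) = f c) ->
          F' eps1 = a1 -> F' eps2 = a2 -> F' =1 F].
Proof.
move=> a1s a2s.
pose F x := f (bd0 x) + f (bd1 x) * a1 + f (bd2 x) * a2 + f (bd12 x) * (a1 * a2).
have Fz : zmod_morphism F by move=> x y; rewrite /F !raddfB; ring.
have Fm : monoid_morphism F.
  split=> [|x y]; first by rewrite /F /= rmorph1 rmorph0; ring.
  rewrite /F /= !(rmorphD, rmorphM) /=; apply/eqP; rewrite -subr_eq0; apply/eqP.
  set u := f _; set v := f _; set u1 := f _; set v1 := f _.
  set u2 := f _; set v2 := f _; set u12 := f _; set v12 := f _.
  transitivity (- a1 ^+ 2 * (u1 * v1 + (u1 * v12 + u12 * v1) * a2)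
                - a2 ^+ 2 * (u2 * v2 + (u2 * v12 + u12 * v2) * a1)
                - a1 ^+ 2 * a2 ^+ 2 * (u12 * v12)); last by rewrite a1s a2s; ring.
  rewrite /u /v /u1 /v1 /u2 /v2 /u12 /v12; ring.
pose FM := GRing.isMonoidMorphism.Build (bidual R) A F Fm.
pose FZ := GRing.isZmodMorphism.Build (bidual R) A F Fz.
pose G : {rmorphism bidual R -> A} := HB.pack F FZ FM.
exists G; split=> [c|||F' F'c F'1 F'2 x]; rewrite /G /= /F /= ?rmorph0 ?rmorph1; try by ring.
by rewrite {1}[x]bidualE !(rmorphD, rmorphM) /= !F'c F'1 F'2.
Qed.

End BidualRing.

Definition doubly_tangential (R : comPzRingType) n (e : 'cV[int]_n)
    (es : 'rV[int]_n) (tau a y : 'M[R]_n) : Prop :=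
  forall y'' : 'M[bidual R]_n,
    in_H_cent e es (@bidual_const R) (compr_H e es tau) y'' ->
    map_mx (@bd0 R) y'' = y ->
    in_X e es (@bidual_const R) tau a y''.

(* Main.v *)
From HB Require Import structures.
Require Import Defs.
From mathcomp Require Import all_boot all_order all_algebra.
Set Implicit Arguments.
Unset Strict Implicit.
Unset Printing Implicit Defensive.
Import GRing.Theory.
Local Open Scope ring_scope.

(** Write [a y = h g] with [h] in H and [g] in G_tau; the claim is that [g] is a
    scalar.  Put [b = e^* g], [c = g^-1 e] and [u_k = 1_H tau_H^k].  Testing the
    hypothesis on [y (1 + eps1 u_i) (1 + eps2 u_j)], the first-order terms give
    [x_k] commuting with [tau] such that [b x_k = b u_k] and [x_k c = u_k c];
    each of these equations determines [x_k].  The [eps1 eps2] term gives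
    [2 x_(i+j) c = 2 x_i x_j c], whence [x_(i+j) = x_i x_j].

    In particular [p = x_0] is idempotent and [X = x_1 = p X].  Comparing
    [X c = tau_H c], [b X = b tau_H] and [X^2 c = tau_H^2 c] with the action of
    [tau] gives scalars with [X = tau p - al g], [al g^2 = al'] and
    [al tau - al2 = al^2 g].  Squaring the last one yields a quadratic relation
    for [tau] with leading coefficient [al^2]; as [1, tau, tau^2] are independent
    in rank at least 3, first [al^2 = 0] and then [al = 0].  So [X = tau p], and
    [e^* tau^k p c = e^* u_k c = 0] for all [k]; since [c] and [e^*] are cyclic,
    [p = 0].  Then [c] is a multiple of [e] and [b] of [e^*], i.e. [g] is a
    scalar. *)

(** * Independence of the powers of an endomorphism that has a cyclic vector *)

Lemma horner_mx_sum (R : comNzRingType) (n m : nat) (A : 'M[R]_n.+1)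
    (c : nat -> R) :
  horner_mx A (\poly_(i < m) c i) = \sum_(i < m) c i *: A ^+ i.
Proof.
rewrite poly_def linear_sum /=; apply: eq_bigr => i _.
rewrite -mul_polyC rmorphM /= rmorphXn /= horner_mx_X horner_mx_C.
by rewrite -[_ * A ^+ i]/(_%:M *m _) mul_scalar_mx.
Qed.

Lemma cyclic_vector_horner_inj (R : comNzRingType) (n : nat)
    (tau : 'M[R]_n.+1) (v : 'cV[R]_n.+1) (p : {poly R}) :
  cyclic_vector tau v -> (size p <= n.+1)%N ->
  horner_mx tau p *m v = 0 -> p = 0.
Proof.
move=> tau_v szp pv0.
(* By Cayley-Hamilton the Krylov matrix K is onto, hence invertible. *)
pose K := \matrix_(i, j < n.+1) (tau ^+ j *m v) i 0.
have KE (q : {poly R}) : (size q <= n.+1)%N ->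
    K *m (\col_(j < n.+1) q`_j) = horner_mx tau q *m v.
  move=> szq; have -> : q = \poly_(i < n.+1) q`_i.
    apply/polyP=> i; rewrite coef_poly; case: ltnP => // /(leq_trans szq) ?.
    by rewrite nth_default.
  rewrite horner_mx_sum mulmx_suml; apply/colP=> i.
  rewrite mxE summxE; apply: eq_bigr => j _.
  by rewrite -scalemxAl !mxE coef_poly ltn_ord mulrC.
have K_onto (i : 'I_n.+1) : exists u, K *m u = delta_mx i 0 :> 'cV[R]_n.+1.
  have [_ [s ->] ->] := tau_v (delta_mx i 0).
  pose d := char_poly tau; have dm : d \is monic := char_poly_monic tau.
  have dp (q : {poly R}) : horner_mx tau (q * d) = 0.
    by rewrite rmorphM /= Cayley_Hamilton mulr0.
  (* The remainder modulo the monic characteristic polynomial has the same value at [tau] and at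
     most n + 1 coefficients, one per column of [K]. *)
  pose q := Pdiv.CommonRing.rmodp (Poly s) d.
  exists (\col_(j < n.+1) q`_j); rewrite KE; last first.
    rewrite -ltnS -[X in (_ < X)%N](size_char_poly tau).
    by rewrite Pdiv.CommonRing.ltn_rmodp monic_neq0.
  congr (_ *m v).
  transitivity (horner_mx tau (Poly s)).
    rewrite [in RHS](Pdiv.RingMonic.rdivp_eq dm (Poly s)) rmorphD /= dp.
    by rewrite add0r.
  have -> : Poly s = \poly_(i < size s) s`_i.
    by apply/polyP=> k; rewrite coef_Poly coef_poly;
       case: ltnP => // ?; rewrite nth_default.
  by rewrite horner_mx_sum.
have [L KL] := fin_all_exists K_onto.
have KL1 : K *m (\matrix_(i, j) L j i 0) = 1%:M.
  apply/matrixP=> i j; rewrite mxE; have /colP/(_ i) := KL j.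
  by rewrite !mxE eqxx andbT => <-; apply: eq_bigr => k _; rewrite !mxE.
(* A right inverse of the square matrix [K] is also a left inverse, so [K] kills only 0. *)
have pc0 : \col_(j < n.+1) p`_j = 0.
  by rewrite -[LHS]mul1mx -(mulmx1C KL1) -mulmxA KE // pv0 mulmx0.
apply/polyP=> i; rewrite coef0; case: (ltnP i n.+1) => [lt_in|].
  by have /colP/(_ (Ordinal lt_in)) := pc0; rewrite !mxE.
by move=> /(leq_trans szp) ?; rewrite nth_default.
Qed.

Lemma cyclic_vector_quadratic (R : comPzRingType) (n : nat)
    (tau : 'M[R]_n) (v : 'cV[R]_n) (c0 c1 c2 : R) :
  (3 <= n)%N -> cyclic_vector tau v ->
  c2 *: (tau *m tau) + c1 *: tau + c0%:M = 0 -> c1 = 0 /\ c2 = 0.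
Proof.
case: n tau v => // n tau v n_ge3 tau_v.
(* Polynomials need a nonzero ring: the zero ring is settled directly, and otherwise [R] is
   repackaged with [1 != 0]. *)
have [R0|R1] := eqVneq (1 : R) 0.
  by split; rewrite -[LHS]mul1r R0 mul0r.
pose RM := GRing.PzSemiRing_isNonZero.Build R R1.
pose R' : comNzRingType := HB.pack R RM.
move=> c_eq; pose p : {poly R'} := Poly [:: (c0 : R'); (c1 : R'); (c2 : R')].
suff p0 : p = 0.
  by split; [have := coef_Poly [:: (c0 : R'); (c1 : R'); (c2 : R')] 1
            |have := coef_Poly [:: (c0 : R'); (c1 : R'); (c2 : R')] 2];
     rewrite -/p p0 coef0 => /esym.
have sp : (size p <= n.+1)%N by apply: leq_trans (size_Poly _) _.
apply: (@cyclic_vector_horner_inj R' n tau v p tau_v sp).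
have -> : horner_mx (tau : 'M[R']_n.+1) p = 0; last by rewrite mul0mx.
rewrite -[RHS]c_eq /p /= !cons_poly_def.
rewrite mul0r add0r !rmorphD !rmorphM !rmorphD !rmorphM /=.
rewrite !horner_mx_X !horner_mx_C.
rewrite -[RHS]/(c2 *: (tau *m tau) + c1 *: tau + c0%:M).
rewrite -!mul_scalar_mx mulrDl mulmxA.
by [].
Qed.

Lemma map_base_change (R R' : comPzRingType) (f : {rmorphism R -> R'}) m n
    (A : 'M[int]_(m, n)) : map_mx f (base_change R A) = base_change R' A.
Proof. by apply/matrixP=> i j; rewrite !mxE rmorph_int. Qed.

(** * Matrices over R[eps1, eps2], handled through their four components *)

Section BidualMatrix.

Variable R : comPzRingType.

Definition bimx m n (A A1 A2 A12 : 'M[R]_(m, n)) : 'M[bidual R]_(m, n) :=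
  \matrix_(i, j) Bidual (A i j) (A1 i j) (A2 i j) (A12 i j).

Lemma bimx_inj m n (A A1 A2 A12 B B1 B2 B12 : 'M[R]_(m, n)) :
  bimx A A1 A2 A12 = bimx B B1 B2 B12 ->
  [/\ A = B, A1 = B1, A2 = B2 & A12 = B12].
Proof.
by move=> /matrixP AB; split; apply/matrixP=> i j;
   have := AB i j; rewrite !mxE => -[].
Qed.

Lemma bimxE m n (A : 'M[bidual R]_(m, n)) :
  exists A0 A1 A2 A12, A = bimx A0 A1 A2 A12.
Proof.
exists (map_mx (@bd0 R) A), (map_mx (@bd1 R) A), (map_mx (@bd2 R) A).
exists (map_mx (@bd12 R) A).
by apply/matrixP=> i j; rewrite !mxE; case: (A i j).
Qed.

Lemma bimx_const m n (A : 'M[R]_(m, n)) :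
  map_mx (@bidual_const R) A = bimx A 0 0 0.
Proof. by apply/matrixP=> i j; rewrite !mxE. Qed.

Lemma map_bd0_bimx m n (A A1 A2 A12 : 'M[R]_(m, n)) :
  map_mx (@bd0 R) (bimx A A1 A2 A12) = A.
Proof. by apply/matrixP=> i j; rewrite !mxE. Qed.

Lemma bidual_sum (I : finType) (F0 F1 F2 F12 : I -> R) :
  \sum_i Bidual (F0 i) (F1 i) (F2 i) (F12 i) =
  Bidual (\sum_i F0 i) (\sum_i F1 i) (\sum_i F2 i) (\sum_i F12 i).
Proof.
by elim: index_enum => [|i s IHs]; rewrite ?big_nil ?big_cons ?IHs.
Qed.

Lemma bimxM m n p (A A1 A2 A12 : 'M[R]_(m, n)) (B B1 B2 B12 : 'M[R]_(n, p)) :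
  bimx A A1 A2 A12 *m bimx B B1 B2 B12 =
  bimx (A *m B) (A *m B1 + A1 *m B) (A *m B2 + A2 *m B)
    (A *m B12 + A1 *m B2 + A2 *m B1 + A12 *m B).
Proof.
apply/matrixP=> i j; rewrite !mxE -!big_split -bidual_sum.
by apply: eq_bigr => k _; rewrite !mxE.
Qed.

Lemma base_change_bidual m n (A : 'M[int]_(m, n)) :
  base_change (bidual R) A = bimx (base_change R A) 0 0 0.
Proof. by rewrite -bimx_const map_base_change. Qed.

End BidualMatrix.

(** * The commutant of an endomorphism with a cyclic vector or covector *)

Section Commutant.

Variables (R : comPzRingType) (n : nat) (tau : 'M[R]_n).

Lemma alg_gen_comm (x y : 'M[R]_n) :
  in_alg_gen tau x -> comm_mx y tau -> comm_mx y x.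
Proof.
move=> [s ->] ytau; rewrite /comm_mx mulmx_sumr mulmx_suml.
apply: eq_bigr => i _; rewrite -scalemxAl -scalemxAr; congr (_ *: _).
exact: (@commrX _ y tau i ytau).
Qed.

(** Each basis vector is [s *m v] with [s] in R[tau], and [s] commutes with [x] and [y], so the
    value at [v] determines every column. *)
Lemma cyclic_vector_comm_inj (v : 'cV[R]_n) (x y : 'M[R]_n) :
  cyclic_vector tau v -> comm_mx x tau -> comm_mx y tau ->
  x *m v = y *m v -> x = y.
Proof.
move=> tau_v xtau ytau xv; apply/trmx_inj/row_matrixP => i.
rewrite -!tr_col; congr _^T; rewrite -[x]mulmx1 -[y]mulmx1 !colE -!mulmxA.
rewrite mul1mx; have [s s_alg ->] := tau_v (delta_mx i 0).
rewrite !mulmxA (alg_gen_comm s_alg xtau) (alg_gen_comm s_alg ytau).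
by rewrite -!mulmxA xv.
Qed.

Lemma cyclic_covector_comm_inj (l : 'rV[R]_n) (x y : 'M[R]_n) :
  cyclic_covector tau l -> comm_mx x tau -> comm_mx y tau ->
  l *m x = l *m y -> x = y.
Proof.
move=> tau_l xtau ytau lx; apply/row_matrixP => i.
rewrite !rowE; have [s s_alg ->] := tau_l (delta_mx 0 i).
rewrite -!mulmxA -(alg_gen_comm s_alg xtau) -(alg_gen_comm s_alg ytau).
by rewrite !mulmxA lx.
Qed.

Lemma comm_tau : comm_mx tau tau.
Proof. by []. Qed.

(** [y] agrees at [v] with some [s] in R[tau], hence equals [s], and [x] commutes with all of
    R[tau]. *)
Lemma cyclic_comm (v : 'cV[R]_n) (x y : 'M[R]_n) :
  cyclic_vector tau v -> comm_mx x tau -> comm_mx y tau -> comm_mx x y.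
Proof.
move=> tau_v xtau ytau; have [s s_alg yv] := tau_v (y *m v).
have stau : comm_mx s tau by apply/comm_mx_sym/(alg_gen_comm s_alg)/comm_tau.
rewrite (cyclic_vector_comm_inj tau_v ytau stau yv).
exact: alg_gen_comm s_alg xtau.
Qed.

Lemma comm_mx_inv (g g' x : 'M[R]_n) :
  g *m g' = 1%:M -> g' *m g = 1%:M -> comm_mx g x -> comm_mx g' x.
Proof.
move=> gg' g'g gx; rewrite /comm_mx -[g' *m x]mulmx1 -gg' mulmxA.
by rewrite -(mulmxA _ x) -gx !mulmxA g'g mul1mx.
Qed.

Lemma cyclic_vector_mul (v : 'cV[R]_n) (g g' : 'M[R]_n) :
  cyclic_vector tau v -> g *m g' = 1%:M -> comm_mx g tau ->
  cyclic_vector tau (g *m v).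
Proof.
move=> tau_v gg' gtau w; have [s s_alg w'E] := tau_v (g' *m w); exists s => //.
by rewrite mulmxA -(alg_gen_comm s_alg gtau) -mulmxA -w'E mulmxA gg' mul1mx.
Qed.

Lemma cyclic_covector_mul (l : 'rV[R]_n) (g g' : 'M[R]_n) :
  cyclic_covector tau l -> g' *m g = 1%:M -> comm_mx g tau ->
  cyclic_covector tau (l *m g).
Proof.
move=> tau_l g'g gtau w; have [s s_alg w'E] := tau_l (w *m g'); exists s => //.
by rewrite -mulmxA (alg_gen_comm s_alg gtau) mulmxA -w'E -mulmxA g'g mulmx1.
Qed.

End Commutant.

(** * Intertwiners for the powers of the compression, and why they force [g] to be scalar *)

Section Compression.

Variables (R : comPzRingType) (n : nat) (e : 'cV[R]_n) (l : 'rV[R]_n).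
Variable tau : 'M[R]_n.
Hypothesis le1 : l *m e = 1%:M.

Let H1 : 'M[R]_n := 1%:M - e *m l.
Let tauH := H1 *m tau *m H1.

(** Starting at [H1], the unit of M_H(R), makes even the zeroth power kill [e] and be killed by
    [l]. *)
Definition compr_pow (k : nat) : 'M[R]_n := iter k (mulmx tauH) H1.
Local Notation u := compr_pow.

Let H1_mul m (w : 'M[R]_(n, m)) : H1 *m w = w - e *m (l *m w).
Proof. by rewrite mulmxBl mul1mx mulmxA. Qed.

Let mul_H1 m (w : 'M[R]_(m, n)) : w *m H1 = w - w *m e *m l.
Proof. by rewrite mulmxBr mulmx1 mulmxA. Qed.

Let H1e : H1 *m e = 0.
Proof. by rewrite H1_mul le1 mulmx1 subrr. Qed.

Let lH1 : l *m H1 = 0.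
Proof. by rewrite mul_H1 le1 mul1mx subrr. Qed.

Let H1K : H1 *m H1 = H1.
Proof. by rewrite H1_mul lH1 mulmx0 subr0. Qed.

Let H1_tauH : H1 *m tauH = tauH.
Proof. by rewrite /tauH !mulmxA H1K. Qed.

Let tauH_H1 : tauH *m H1 = tauH.
Proof. by rewrite /tauH -!mulmxA H1K. Qed.

Lemma compr_pow_e k : u k *m e = 0.
Proof. by elim: k => //= k IHk; rewrite -mulmxA IHk mulmx0. Qed.

Lemma l_compr_pow k : l *m u k = 0.
Proof. by case: k => //= k; rewrite -H1_tauH !mulmxA lH1 !mul0mx. Qed.

Let H1_compr_pow k : H1 *m u k = u k.
Proof. by rewrite H1_mul l_compr_pow mulmx0 subr0. Qed.

Lemma compr_powD i j : u i *m u j = u (i + j).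
Proof. by elim: i => //= i IHi; rewrite -mulmxA IHi. Qed.

Lemma compr_pow_comm k : u k *m tauH = tauH *m u k.
Proof.
elim: k => /= [|k IHk]; first by rewrite H1_tauH tauH_H1.
by rewrite -mulmxA IHk.
Qed.

Variables g g' : 'M[R]_n.
Hypotheses (n_ge3 : (3 <= n)%N) (tau_e : cyclic_vector tau e)
  (tau_l : cyclic_covector tau l) (gg' : g *m g' = 1%:M) (gtau : comm_mx g tau).

Let b := l *m g.
Let c := g' *m e.

(* [x] plays the role of [u k] = 1_H tau_H^k inside the centralizer of [tau]. *)
Definition intertwines k (x : 'M[R]_n) :=
  [/\ comm_mx x tau, b *m x = b *m u k & x *m c = u k *m c].

(** These two hypotheses carry all that double tangency contributes;
    [doubly_tangential_intertwiners] supplies them. *)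
Hypothesis intertwiner : forall k, exists x, intertwines k x.
Hypothesis intertwinesM : forall i j x y,
  intertwines i x -> intertwines j y -> intertwines (i + j) (x *m y).

Let g'g : g' *m g = 1%:M := mulmx1C gg'.
Let g'tau : comm_mx g' tau := comm_mx_inv gg' g'g gtau.
Let tau_c : cyclic_vector tau c := cyclic_vector_mul tau_e g'g g'tau.
Let tau_b : cyclic_covector tau b := cyclic_covector_mul tau_l g'g gtau.
Let gc : g *m c = e. Proof. by rewrite mulmxA gg' mul1mx. Qed.
Let bg' : b *m g' = l. Proof. by rewrite -mulmxA gg' mulmx1. Qed.

Let injc x y : comm_mx x tau -> comm_mx y tau -> x *m c = y *m c -> x = y.
Proof. exact: cyclic_vector_comm_inj tau_c. Qed.

Let injb x y : comm_mx x tau -> comm_mx y tau -> b *m x = b *m y -> x = y.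
Proof. exact: cyclic_covector_comm_inj tau_b. Qed.

Let intertwines_inj k x y : intertwines k x -> intertwines k y -> x = y.
Proof. by case=> [? ? xc] [? ? yc]; apply: injc; rewrite // xc yc. Qed.

Let commZ a x : comm_mx x tau -> comm_mx (a *: x) tau.
Proof. by rewrite /comm_mx -scalemxAl -scalemxAr => ->. Qed.

Lemma intertwiner_scalar : exists2 a, is_unit a & g = a%:M.
Proof.
have [p p0] := intertwiner 0; have [X X1] := intertwiner 1.
(* As 0 + 0 = 0 and 0 + 1 = 1, uniqueness of intertwiners gives both identities. *)
have pp : p *m p = p by apply: intertwines_inj (intertwinesM p0 p0) p0.
have pX : p *m X = X by apply: intertwines_inj (intertwinesM p0 X1) X1.
have [ptau bp pc] := p0; have [Xtau bX Xc] := X1.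
have [XXtau _ XXc] := intertwinesM X1 X1.
(* The rank-one corrections coming from 1_H become values at [c] or [b] of multiples of [g] or [g'],
   which commute with [tau]; [injc] and [injb] then apply. *)
have e_scal (a : 'M[R]_1) : e *m a = (a 0 0) *: (g *m c).
  by rewrite gc [in LHS](mx11_scalar a) mul_mx_scalar.
have l_scal (a : 'M[R]_1) : a *m l = (a 0 0) *: (b *m g').
  by rewrite bg' [in LHS](mx11_scalar a) mul_scalar_mx.
pose al := (l *m (tau *m (p *m c))) 0 0.
pose al' := (b *m p *m tau *m e) 0 0.
pose al2 := (l *m (tau *m (X *m c))) 0 0.
(* [X c = 1_H tau 1_H c] with [1_H c = p c]; the left factor 1_H subtracts
   [e (l tau p c) = al g c]. *)
have XE : X = tau *m p - al *: g.
  apply: injc => //.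
    apply/comm_mx_sym/comm_mxB; last by apply/comm_mx_sym/commZ.
    by apply: comm_mxM => //; apply/comm_mx_sym.
  rewrite Xc /= tauH_H1 /tauH -!mulmxA -[H1 *m c]pc H1_mul e_scal.
  by rewrite -/al mulmxBl -scalemxAl mulmxA.
(* Multiplying [XE] by [p] fixes [X] and [tau p], so [al p g = al g]. *)
have alp : al *: p = al%:M.
  have: al *: (p *m g) = al *: g.
    apply: (can_inj (subKr (tau *m p))).
    by rewrite /= -XE -[RHS]pX XE mulmxBr -scalemxAr mulmxA ptau -(mulmxA tau) pp.
  move/(congr1 (mulmx^~ g')).
  by rewrite -!scalemxAl -mulmxA gg' mulmx1 scalemx1.
have al_gg : al *: (g *m g) = al'%:M.
  (* The same computation on the covector side, with [b] in place of [c]. *)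
  have XE' : X = tau *m p - al' *: g'.
    apply: injb => //.
      apply/comm_mx_sym/comm_mxB; last by apply/comm_mx_sym/commZ.
      by apply: comm_mxM => //; apply/comm_mx_sym.
    rewrite bX /= tauH_H1 /tauH !mulmxA -[b *m H1]/(b *m u 0) -bp mul_H1 l_scal.
    by rewrite mulmxBr -ptau !mulmxA scalemxAr.
  have: al *: g = al' *: g'.
    by apply: (can_inj (subKr (tau *m p))); rewrite -XE -XE'.
  by move/(congr1 (mulmx^~ g)); rewrite -!scalemxAl g'g scalemx1.
have XXE : X *m X = tau *m X - al2 *: g.
  apply: injc => //.
    apply/comm_mx_sym/comm_mxB; last by apply/comm_mx_sym/commZ.
    by apply: comm_mxM => //; apply/comm_mx_sym.
  have H1Xc : H1 *m (X *m c) = X *m c by rewrite Xc mulmxA H1_compr_pow.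
  rewrite XXc -[u 2]/(tauH *m u 1) -mulmxA -Xc /tauH -!mulmxA H1Xc H1_mul.
  by rewrite e_scal -/al2 mulmxBl -scalemxAl mulmxA.
(* Since [p X = X], [XE] also gives [X X = tau X - al g X]; compare with [XXE]. *)
have alX : al *: X = al2%:M.
  have: al *: (g *m X) = al2 *: g.
    apply: (can_inj (subKr (tau *m X))).
    by rewrite -XXE {3}XE mulmxBl -mulmxA pX scalemxAl.
  move/(congr1 (mulmx g')).
  by rewrite -!scalemxAr mulmxA g'g mul1mx scalemx1.
have al_tau : al *: tau - al2%:M = (al * al) *: g.
  rewrite -alX XE scalerBr scalerA opprB addrC -addrA scalemxAr alp.
  by rewrite mul_mx_scalar addNr addr0.
have al_quad : (al * al) *: (tau *m tau) + (- (al * al2 *+ 2)) *: tau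
    + (al2 * al2 - al * al * al * al')%:M = 0.
  have: (al *: tau - al2%:M) *m (al *: tau - al2%:M) = (al * al * al * al')%:M.
    rewrite al_tau -scalemxAl -scalemxAr scalerA -scalemx1 -[RHS]scalerA.
    by rewrite scalemx1 -al_gg scalerA; congr (_ *: _); rewrite !mulrA.
  rewrite mulmxBl !mulmxBr -!scalemxAl -!scalemxAr.
  rewrite mul_mx_scalar mul_scalar_mx mul_mx_scalar !scalerA.
  move=> q; rewrite raddfB /= -q scale_scalar_mx.
  rewrite scaleNr mulr2n scalerDl.
  set A := _ *: (tau *m tau); set B := _ *: tau; set C := _%:M.
  have -> : A - B - (B - C) = A - (B + B) + C.
    by rewrite opprB opprD [C - B]addrC !addrA.
  by rewrite addrA addrN.
have [_ al_al] := cyclic_vector_quadratic n_ge3 tau_e al_quad.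
(* Now [al tau - al2 = 0], a quadratic relation with leading coefficient 0. *)
have al0 : al = 0.
  have: 0 *: (tau *m tau) + al *: tau + (- al2)%:M = 0.
    by rewrite scale0r add0r raddfN /= al_tau al_al scale0r.
  by case/(cyclic_vector_quadratic n_ge3 tau_e).
have {}XE : X = tau *m p by rewrite XE al0 scale0r subr0.
have tau_pow k : intertwines k (tau ^+ k *m p).
  elim: k => [|k IHk]; first by rewrite mul1mx.
  have := intertwinesM X1 IHk; rewrite XE exprS -[tau * _]/(tau *m _).
  congr (intertwines _ _).
  rewrite -!mulmxA; congr (_ *m _).
  by rewrite mulmxA (commrX k ptau : p *m _ = _) -mulmxA pp.
have lp0 : l *m p = 0.
  apply/trmx_inj/row_matrixP => i; rewrite -!tr_col; congr _^T.
  rewrite !colE mul0mx; have [_ [s ->] ->] := tau_c (delta_mx i 0).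
  rewrite mulmx_suml mulmx_sumr big1 // => j _; rewrite -scalemxAl -scalemxAr.
  rewrite mulmxA -(mulmxA l) (commrX j ptau : p *m _ = _) -mulmxA.
  by have [_ _ ->] := tau_pow j; rewrite mulmxA l_compr_pow mul0mx scaler0.
have p_eq0 : p = 0.
  by apply: (cyclic_covector_comm_inj tau_l); rewrite // ?lp0 ?mulmx0 //
     /comm_mx mul0mx mulmx0.
(* With [p = 0], the zeroth intertwining equations say [b 1_H = 0] and [1_H c = 0]. *)
pose be := (b *m e) 0 0; pose ga := (l *m c) 0 0.
have bE : b = be *: l.
  move: bp; rewrite p_eq0 mulmx0 mul_H1 => /esym/subr0_eq {1}->.
  by rewrite [in LHS](mx11_scalar (b *m e)) mul_scalar_mx.
have cE : c = ga *: e.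
  move: pc; rewrite p_eq0 mul0mx H1_mul => /esym/subr0_eq {1}->.
  by rewrite [in LHS](mx11_scalar (l *m c)) mul_mx_scalar.
exists be; last first.
  apply: (cyclic_covector_comm_inj tau_l) => //; last by rewrite mul_mx_scalar.
  by rewrite /comm_mx mul_scalar_mx mul_mx_scalar.
(* [ga] inverts [be]: [b c = l g g' e = 1], while [b c = be ga (l e)]. *)
exists ga.
have : b *m c = 1%:M by rewrite -mulmxA gc.
rewrite bE cE -scalemxAl -scalemxAr scalerA le1 scalemx1.
by move/matrixP/(_ 0 0); rewrite !mxE eqxx !mulr1n.
Qed.
End Compression.

(** * Products and inverses in H *)

Section HGroup.

Variables (n : nat) (e : 'cV[int]_n) (es : 'rV[int]_n) (R : comPzRingType).

Lemma in_H_mul (g h : 'M[R]_n) :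
  in_H e es g -> in_H e es h -> in_H e es (g *m h).
Proof.
case=> [[g' [gg' g'g]] ge lg] [[h' [hh' h'h]] he lh]; split.
- exists (h' *m g'); rewrite !mulmxA -(mulmxA g) hh' mulmx1.
  by rewrite -(mulmxA h') g'g mulmx1.
- by rewrite -mulmxA he.
- by rewrite mulmxA lg.
Qed.

Lemma in_H_inv (g : 'M[R]_n) : in_H e es g ->
  exists g' : 'M[R]_n, [/\ in_H e es g', g *m g' = 1%:M & g' *m g = 1%:M].
Proof.
case=> [[g' [gg' g'g]] ge lg]; exists g'; split=> //; split.
- by exists g.
- by rewrite -[in LHS]ge mulmxA g'g mul1mx.
- by rewrite -[in LHS]lg -mulmxA gg' mulmx1.
Qed.

End HGroup.

(** * Extracting intertwiners from a deformation of [y] *)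

Section Tangential.

Variables (n : nat) (e : 'cV[int]_n) (es : 'rV[int]_n) (e_es : es *m e = 1%:M).
Variables (R : comPzRingType) (tau a y h g g' : 'M[R]_n).
Hypotheses (y_H : in_H_cent e es (idfun : {rmorphism R -> R})
              (compr_H e es tau) y)
  (h_H : in_H e es h) (ayE : a *m y = h *m g)
  (gg' : g *m g' = 1%:M) (gtau : comm_mx g tau).

Local Notation eR := (base_change R e).
Local Notation lR := (base_change R es).
Local Notation u := (compr_pow eR lR tau).

Lemma base_change_pairing : lR *m eR = 1%:M.
Proof. by rewrite -map_mxM e_es map_scalar_mx rmorph1. Qed.
Let le1 := base_change_pairing.

(* [s + s1 eps1 + s2 eps2 + s12 eps1 eps2] is [g^-1 g''], where [g''] is the
   factor in the centralizer of [tau] of the deformed element. *)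
Lemma tangential_intertwiners (i j : nat) :
  doubly_tangential e es tau a y ->
  exists s s1 s2 s12 : 'M[R]_n,
    [/\ [/\ comm_mx s tau, comm_mx s1 tau, comm_mx s2 tau & comm_mx s12 tau],
        [/\ lR *m g *m s = lR *m g, lR *m g *m s1 = lR *m g *m u i,
            lR *m g *m s2 = lR *m g *m u j
          & lR *m g *m s12 = lR *m g *m u (i + j)]
      & let c := g' *m eR in
        [/\ s *m c = c, s1 *m c = s *m u i *m c, s2 *m c = s *m u j *m c
          & s *m u (i + j) *m c + s12 *m c
            = s1 *m u j *m c + s2 *m u i *m c]].
Proof.
move=> tang.
have [[[y' [yy' y'y]] ye ly] ytau] := y_H.
have {}ytau : y *m compr_H e es tau = compr_H e es tau *m y.
  by move: ytau; rewrite map_mx_id.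
have ue k : u k *m eR = 0 by apply: compr_pow_e.
have lu k : lR *m u k = 0 by apply: l_compr_pow.
have utau k : u k *m compr_H e es tau = compr_H e es tau *m u k.
  exact: compr_pow_comm.
have yutau k :
    y *m u k *m compr_H e es tau = compr_H e es tau *m (y *m u k).
  by rewrite -[LHS]mulmxA utau [LHS]mulmxA ytau -[LHS]mulmxA.
have uu k m : u k *m u m = u (k + m) by apply: compr_powD.
(* Y = (1 + eps1 u_i) (1 + eps2 u_j). *)
pose Y := bimx 1%:M (u i) (u j) (u (i + j)).
(* The inverse (1 - eps1 u_i) (1 - eps2 u_j), as each eps squares to 0 and the u's commute. *)
pose Y' := bimx 1%:M (- u i) (- u j) (u (i + j)).
have YY' : Y *m Y' = 1%:M.
  rewrite bimxM !mul1mx !mulmx1 !mulmxN !uu (addnC j) !addNr.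
  by rewrite subrr sub0r addNr -bimx_const map_scalar_mx rmorph1.
(* [y Y] is an admissible lift of [y]: each [u k] kills e, is killed by e^* and commutes with
   tau_H. *)
have [||_ [H [G [[[H' [HH' H'H]] He lH] [[G' [GG' G'G]] Gtau] aYE]]]] :=
    tang (bimx y 0 0 0 *m Y).
- split; first split.
  + exists (Y' *m bimx y' 0 0 0).
    have yy'' : bimx y 0 0 0 *m bimx y' 0 0 0 = 1%:M.
      by rewrite -!bimx_const -map_mxM yy' map_scalar_mx rmorph1.
    have P : bimx y 0 0 0 *m Y *m (Y' *m bimx y' 0 0 0) = 1%:M.
      by rewrite mulmxA -(mulmxA _ Y) YY' mulmx1.
    by split=> //; apply: mulmx1C.
  + rewrite base_change_bidual -mulmxA !bimxM !ue.
    by rewrite !(mul0mx, mulmx0, mul1mx, mulmx1, addr0) ye.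
  + rewrite base_change_bidual mulmxA !bimxM ly.
    by rewrite !(mul0mx, mulmx0, mul1mx, mulmx1, addr0) !lu.
  + rewrite bimx_const !bimxM.
    rewrite !(mul0mx, mulmx0, mul1mx, mulmx1, addr0, add0r).
    by rewrite ytau !yutau.
- by rewrite bimxM map_bd0_bimx mulmx1.
move: GG' G'G Gtau aYE He lH; rewrite !base_change_bidual !bimx_const.
move=> GG' G'G Gtau aYE He lH.
pose C A : 'M[bidual R]_n := bimx A 0 0 0.
have CM A B : C A *m C B = C (A *m B).
  by rewrite bimxM !(mul0mx, mulmx0, addr0).
have C1 : C 1%:M = 1%:M by rewrite /C -bimx_const map_scalar_mx rmorph1.
have {}aYE : H *m G = C h *m C g *m Y.
  by rewrite -aYE mulmxA -/(C a) -/(C y) !CM ayE.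
have [_ he lh] := h_H.
pose S := C g' *m G.
have gS : C g *m S = G by rewrite mulmxA CM gg' C1 mul1mx.
(* [H] and [h] preserve e^*, so applying e^* to [H G = h g Y] eliminates both. *)
have lS : bimx lR 0 0 0 *m C g *m S = bimx lR 0 0 0 *m C g *m Y.
  transitivity (bimx lR 0 0 0 *m (H *m G)); first by rewrite -mulmxA gS mulmxA lH.
  rewrite aYE !mulmxA; congr (_ *m _ *m _).
  by rewrite bimxM !(mul0mx, mulmx0, addr0) lh.
pose c := g' *m eR.
(* Dually [S Y' = g' H' h g], where [g c = e] is fixed by [h] and [H']. *)
have Sc : S *m Y' *m bimx c 0 0 0 = bimx c 0 0 0.
  have -> : bimx c 0 0 0 = C g' *m bimx eR 0 0 0.
    by rewrite bimxM !(mul0mx, mulmx0, addr0).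
  rewrite /S -[G]mul1mx -H'H -(mulmxA H') aYE !mulmxA -(mulmxA _ Y) YY' mulmx1.
  rewrite -(mulmxA _ (C g)) CM gg' C1 mulmx1 -(mulmxA _ (C h)).
  rewrite bimxM !(mul0mx, mulmx0, addr0) he -(mulmxA _ H') -{1}He.
  by rewrite (mulmxA H') H'H mul1mx.
have Stau : S *m C tau = C tau *m S.
  rewrite /S -mulmxA Gtau !mulmxA !CM.
  by rewrite (comm_mx_inv gg' (mulmx1C gg') gtau).
have [s [s1 [s2 [s12 SE]]]] := bimxE S.
exists s, s1, s2, s12; move: lS Sc Stau; rewrite SE !bimxM.
rewrite !(mul0mx, mulmx0, addr0, add0r, mulmx1, mulmxN).
move=> /bimx_inj[ls ls1 ls2 ls12] /bimx_inj[sc s1c s2c s12c].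
move=> /bimx_inj[stau s1tau s2tau s12tau]; split; split=> //.
- by apply: subr0_eq; rewrite -s1c mulmxDl addrC mulNmx.
- by apply: subr0_eq; rewrite -s2c mulmxDl addrC mulNmx.
- move: s12c; rewrite !mulmxDl !mulNmx => s12c; apply: subr0_eq.
  by rewrite -s12c opprD -!addrA; congr (_ + _); rewrite addrC addrA.
Qed.
End Tangential.

Lemma doubly_tangential_intertwiners (n : nat) (e : 'cV[int]_n)
    (es : 'rV[int]_n) (R : comPzRingType) (tau a y h g g' : 'M[R]_n) :
  es *m e = 1%:M -> is_unit (2%:R : R) -> stable e es tau ->
  in_H_cent e es (idfun : {rmorphism R -> R}) (compr_H e es tau) y ->
  in_H e es h -> a *m y = h *m g -> g *m g' = 1%:M -> comm_mx g tau ->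
  doubly_tangential e es tau a y ->
  let P := intertwines (base_change R e) (base_change R es) tau g g' in
  (forall k, exists x, P k x) /\
  (forall i j x z, P i x -> P j z -> P (i + j)%N (x *m z)).
Proof.
move=> e_es [half half2] [tau_e tau_l] yH hH ayE gg' gtau tang P.
have g'g := mulmx1C gg'.
set c := g' *m base_change R e.
have tau_c : cyclic_vector tau c.
  exact: cyclic_vector_mul tau_e g'g (comm_mx_inv gg' g'g gtau).
have injb := cyclic_covector_comm_inj (cyclic_covector_mul tau_l g'g gtau).
have ex_rel i j : exists s1 s2 s12 : 'M[R]_n,
    [/\ P i s1, P j s2
      & let u := compr_pow (base_change R e) (base_change R es) tau in
        [/\ comm_mx s12 tau,
            base_change R es *m g *m s12 = base_change R es *m g *m u (i + j)%N
          & u (i + j)%N *m c + s12 *m c = s1 *m u j *m c + s2 *m u i *m c]].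
  have [s [s1 [s2 [s12 [[st s1t s2t s12t] [ls ls1 ls2 ls12]]]]]] :=
    tangential_intertwiners e_es yH hH ayE gg' gtau i j tang.
  (* The constant term satisfies [b s = b] with [b = e^* g] cyclic. *)
  have -> : s = 1%:M by apply: injb; rewrite ?mulmx1 //; apply/comm_mx_sym/comm_mx1.
  rewrite !mul1mx => -[_ s1c s2c s12c].
  by exists s1, s2, s12; split.
have exP k : exists x, P k x.
  by have [x [_ [_ [Px _ _]]]] := ex_rel k 0; exists x.
split=> // i j x z Px Pz.
have [s1 [s2 [s12 [[s1t ls1 _] [s2t ls2 _] [s12t ls12]]]]] := ex_rel i j.
have [xt lx xc] := Px; have [zt lz zc] := Pz.
have [w [wt lw wc]] := exP (i + j)%N.
have -> : s1 = x by apply: injb; rewrite // ls1 lx.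
have -> : s2 = z by apply: injb; rewrite // ls2 lz.
have -> : s12 = w by apply: injb; rewrite // ls12 lw.
(* The eps1 eps2 equation becomes [w c + w c = x z c + z x c]; [x] and [z] commute, and 2 can be
   cancelled. *)
rewrite -wc -!mulmxA -xc -zc !mulmxA -(cyclic_comm tau_e xt zt).
rewrite -!mulr2n -!scaler_nat => /(congr1 ( *:%R half)).
rewrite !scalerA [half * _]mulrC half2 !scale1r => wxz.
suff <- : w = x *m z by split.
apply: (cyclic_vector_comm_inj tau_c) => //; last by rewrite !mulmxA.
by apply/comm_mx_sym/comm_mxM; apply/comm_mx_sym.
Qed.

(** * Functoriality of H, and the equivalence of (i) and (ii) *)

Lemma in_H_map (n : nat) (e : 'cV[int]_n) (es : 'rV[int]_n)
    (R R' : comPzRingType) (f : {rmorphism R -> R'}) (h : 'M[R]_n) :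
  in_H e es h -> in_H e es (map_mx f h).
Proof.
case=> [[h' [hh' h'h]] he lh]; split.
- by exists (map_mx f h'); rewrite -!map_mxM hh' h'h map_scalar_mx rmorph1.
- by rewrite -!(map_base_change f) -map_mxM he.
- by rewrite -!(map_base_change f) -map_mxM lh.
Qed.

Unset Implicit Arguments.

Theorem theorem5p6 (n : nat) (e : 'cV[int]_n) (es : 'rV[int]_n)
    (e_es : es *m e = 1%:M) (n_ge3 : (3 <= n)%N)
    (R : comPzRingType) (unit2 : is_unit (2%:R : R))
    (tau a y : 'M[R]_n)
    (tau_stable : stable e es tau) (a_G : in_G a)
    (y_X : in_X e es (idfun : {rmorphism R -> R}) tau a y) :
  doubly_tangential e es tau a y <->
  exists h z : 'M[R]_n, [/\ in_H e es h, in_Z z & a = h *m z].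
Proof.
split=> [tang | [h [_ [h_H [c [c' cc'] ->] aE]]] y'' y''_H _].
  have [yH [h [g [hH [[g' [gg' g'g]]]]]]] := y_X.
  rewrite !map_mx_id // => gtau ayE.
  have [exP PM] := doubly_tangential_intertwiners e_es unit2 tau_stable yH hH
    ayE gg' gtau tang.
  have [tau_e tau_l] := tau_stable.
  have [r r_unit gE] := intertwiner_scalar (base_change_pairing e_es R) n_ge3
    tau_e tau_l gg' gtau exP PM.
  (* With [g = r] scalar, [a = h r y' = (h y') r]. *)
  have [y' [y'H yy' _]] := in_H_inv yH.1.
  exists (h *m y'), r%:M; split; [exact: in_H_mul | by exists r |].
  by rewrite -[a]mulmx1 -yy' mulmxA ayE gE -!mulmxA scalar_mxC.
(* Scalars are central, so [a y'' = (h y'') c], and the unit [c] centralizes [tau]. *)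
split=> //; exists (map_mx (@bidual_const R) h *m y''), (bidual_const c)%:M.
split.
- by case: y''_H => y''_H _; apply: in_H_mul (in_H_map _ h_H) y''_H.
- split; last by rewrite scalar_mxC.
  exists (bidual_const c')%:M.
  by split; rewrite -scalar_mxM -rmorphM /= ?[c' * c]mulrC cc' rmorph1.
- by rewrite aE map_mxM map_scalar_mx -!mulmxA scalar_mxC.
Qed.
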